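(* Let $M$ be a nonempty set, let $F:M\times M\to\mathbb{R}\cup\{-\infty,\infty\}$ be triangular and reflexive, and let $\mu(x)=\sup\{-F(x,y):y\in M\}$, $x\in M$. Let $d$ and $e$ be almost metrics on $M$. Suppose that $\mu$ is proper, i.e. $\mathrm{Dom}(\mu)=\{x\in M:\mu(x)<\infty\}\ne\emptyset$; that $(d,F)$ is semi descending complete; and that $e$ is $d$-compatible. Then for each $u\in\mathrm{Dom}(\mu)$ there exists $v=v(u)\in M$ such that (i) $e(u,v)\le -F(u,v)\le\mu(u)\ (<\infty)$; (ii) $e(v,x)>-F(v,x)$ for all $x\in M\setminus\{v\}$. Hence, in particular, $v$ is an equilibrium point for $G:=F+e$, i.e. $G(v,x)\ge0$ for all $x\in M$.
   Context: $\mathbb{R}_+=[0,\infty)$. A function $F:M\times M\to\mathbb{R}\cup\{-\infty,\infty\}$ is triangular if $F(x,z)\le F(x,y)+F(y,z)$ whenever the right-hand side exists, and reflexive if $F(x,x)=0$ for all $x\in M$. An almost metric on $M$ is a map $d:M\times M\to\mathbb{R}_+$ (not necessarily symmetric) with $d(x,z)\le d(x,y)+d(y,z)$ for all $x,y,z$, and $d(x,y)=0\iff x=y$. A sequence $(x_n)$ is $d$-Cauchy if for each $\delta>0$ there is $n(\delta)$ such that $n(\delta)\le p\le q$ implies $d(x_p,x_q)\le\delta$; $x_n\stackrel{d}{\to}x$ iff $d(x_n,x)\to0$. The same definitions apply to $e$. For $\varphi:M\to\mathbb{R}\cup\{\infty\}$ put $\mathrm{Dom}(\varphi)=\{x\in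 M:\varphi(x)<\infty\}$; $\varphi$ is inf-proper if $\mathrm{Dom}(\varphi)\ne\emptyset$ and $\inf\varphi(M)>-\infty$. For inf-proper $\varphi$, the pair $(d,\varphi)$ is descending complete if for each $d$-Cauchy sequence $(x_n)$ in $\mathrm{Dom}(\varphi)$ with $(\varphi(x_n))$ descending (nonincreasing) there exists $x\in M$ with $x_n\stackrel{d}{\to}x$ and $\lim_n\varphi(x_n)\ge\varphi(x)$. For $u\in\mathrm{Dom}(\mu)$ put $F_u(\cdot)=F(u,\cdot)$; since $F_u(u)=0$ and $\inf F_u(M)=-\mu(u)>-\infty$, $F_u$ is an inf-proper function $M\to\mathbb{R}\cup\{\infty\}$. The pair $(d,F)$ is semi descending complete if $(d,F_u)$ is descending complete for each $u\in\mathrm{Dom}(\mu)$. The almost metric $e$ is $d$-compatible if each $e$-Cauchy sequence is $d$-Cauchy, and for each $x\in M$ the map $y\mapsto e(x,y)$ is $d$-lsc, i.e. $\liminf_n e(x,y_n)\ge e(x,y)$ whenever $y_n\stackrel{d}{\to}y$. *)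

(* Defs.v *)
From mathcomp Require Import all_boot all_order all_algebra.
From mathcomp Require Import all_classical all_reals all_analysis.
Set Implicit Arguments.
Unset Strict Implicit.
Unset Printing Implicit Defensive.
Import Order.TTheory GRing.Theory Num.Theory.
Import numFieldNormedType.Exports.

Local Open Scope classical_set_scope.
Local Open Scope ring_scope.
Local Open Scope ereal_scope.

(* [x +? y] excludes exactly the undefined sums of infinities of opposite
   signs. *)
Definition triangular (R : realType) (M : Type) (F : M -> M -> \bar R) : Prop :=
  forall x y z, F x y +? F y z -> F x z <= F x y + F y z.

Definition reflexive_fun (R : realType) (M : Type) (F : M -> M -> \bar R) :
    Prop :=
  forall x, F x x = 0.

Record almost_metric (R : realType) (M : Type) (d : M -> M -> R) : Prop := {
  almost_metric_ge0 : forall x y, (0 <= d x y)%R ;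
  almost_metric_triangle : forall x y z, (d x z <= d x y + d y z)%R ;
  almost_metric_eq0 : forall x y, d x y = 0%R <-> x = y }.

(* As [d] need not be symmetric, the order of the arguments of [d] matters in
   the next two definitions. *)
Definition am_cauchy (R : realType) (M : Type) (d : M -> M -> R)
    (x_ : nat -> M) : Prop :=
  forall delta : R, (0 < delta)%R ->
    exists N : nat, forall p q : nat,
      (N <= p)%N -> (p <= q)%N -> (d (x_ p) (x_ q) <= delta)%R.

Definition am_cvg (R : realType) (M : Type) (d : M -> M -> R)
    (x_ : nat -> M) (x : M) : Prop :=
  (fun n => d (x_ n) x) @ \oo --> (0%R : R).

Definition Dom (R : realType) (M : Type) (phi : M -> \bar R) : set M :=
  [set x | phi x < +oo].

Definition inf_proper (R : realType) (M : Type) (phi : M -> \bar R) : Prop :=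
  Dom phi !=set0 /\ -oo < ereal_inf (range phi).

(* Only meant for inf-proper [phi]. The limit below always exists in [\bar R],
   since the sequence of values is nonincreasing. *)
Definition descending_complete (R : realType) (M : Type) (d : M -> M -> R)
    (phi : M -> \bar R) : Prop :=
  forall x_ : nat -> M,
    (forall n, Dom phi (x_ n)) ->
    am_cauchy d x_ ->
    nonincreasing_seq (fun n => phi (x_ n)) ->
    exists x : M, am_cvg d x_ x /\ phi x <= limn (fun n => phi (x_ n)).

Definition mu (R : realType) (M : Type) (F : M -> M -> \bar R) (x : M) :
    \bar R :=
  ereal_sup [set - F x y | y in [set: M]].

Lemma inf_proper_section (R : realType) (M : Type) (F : M -> M -> \bar R)
    (u : M) :
  reflexive_fun F -> Dom (mu F) u -> inf_proper (F u).
Proof.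
move=> F0 muu; split; first by exists u; rewrite /Dom /= F0.
apply: (@lt_le_trans _ _ (- mu F u)); first by rewrite lteNr.
apply: le_ereal_inf_tmp => _ [y _ <-]; rewrite leeNl.
by apply: ereal_sup_ubound; exists y.
Qed.

(* By [inf_proper_section], every [F u] below is inf-proper when [F] is
   reflexive. *)
Definition semi_descending_complete (R : realType) (M : Type)
    (d : M -> M -> R) (F : M -> M -> \bar R) : Prop :=
  forall u, Dom (mu F) u -> descending_complete d (F u).

(* The lower limit is taken in [\bar R], as [e x (y_ n)] may be unbounded. *)
Definition am_lsc (R : realType) (M : Type) (d : M -> M -> R) (f : M -> R) :
    Prop :=
  forall (y_ : nat -> M) (y : M), am_cvg d y_ y ->
    (f y)%:E <= limn_einf (fun n => (f (y_ n))%:E).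

Definition am_compatible (R : realType) (M : Type) (d e : M -> M -> R) : Prop :=
  (forall x_ : nat -> M, am_cauchy e x_ -> am_cauchy d x_) /\
  (forall x : M, am_lsc d (e x)).

Definition equilibrium_point (R : realType) (M : Type) (G : M -> M -> \bar R)
    (v : M) : Prop :=
  forall x, 0 <= G v x.

(* Main.v *)
Require Import Defs.
From mathcomp Require Import all_boot all_order all_algebra.
From mathcomp Require Import all_classical all_reals all_analysis.
Set Implicit Arguments.
Unset Strict Implicit.
Unset Printing Implicit Defensive.
Import Order.TTheory GRing.Theory Num.Theory.
Import numFieldNormedType.Exports.
Local Open Scope classical_set_scope.
Local Open Scope ring_scope.
Local Open Scope ereal_scope.

(** The theorem is an instance of Ekeland's variational principle. Fix [u] and
put [phi := F u], which is bounded below by [- mu F u] and vanishes at [u].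

The principle ([ekeland_variational]) orders [M] by Brondsted's relation: [x]
precedes [y] when [phi y + e x y <= phi x]. Starting at [u], choose successors
whose [phi]-value is within [1/(n+1)] of the infimum over all successors of the
current point. Along the chain [e x_p x_q <= phi x_p - phi x_q], so boundedness
below makes it [e]-Cauchy, hence [d]-Cauchy, and completeness gives a [d]-limit
[v] with [phi v <= L], where [L] is the limit of [phi x_n]. Lower
semicontinuity of [e x_n] puts [v] above every [x_n]. A point [y] above [v] is
then above every [x_n] as well, so near-minimality forces [L <= phi y], whence
[phi v <= phi y <= phi v - e v y] and [y = v]: the point [v] is maximal.

That [u] precedes [v] says [e u v <= - F u v]. If [x] differs from [v],
maximality says [F u v < e v x + F u x], and the triangular inequality
[F u x <= F u v + F v x] cancels the finite number [F u v], leaving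
[0 < F v x + e v x]. It is essential to keep to the one section [F u] along the
whole chain, instead of ordering [M] by [e x y <= - F x y]: [d]-limits may fail
to be unique, so the sections at the various [x_n] could yield different limits,
and the triangular inequality does not bound [F x_n v] from above by [F u v]. *)

Lemma limn_einf_le_near (R : realType) (g : nat -> \bar R) (c : \bar R)
    (N : nat) :
  (forall m, (N <= m)%N -> g m <= c) -> limn_einf g <= c.
Proof.
move=> gc; rewrite limn_einf_lim; apply: lime_le; first exact: is_cvg_einfs.
apply: nearW => k; apply: (@le_trans _ _ (g (k + N)%N)).
  by apply: ereal_inf_lbound; exists (k + N)%N => //=; rewrite leq_addr.
by apply: gc; rewrite leq_addl.
Qed.

Section Ekeland.
Variables (R : realType) (M : Type) (e : M -> M -> R) (phi : M -> \bar R).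
Hypothesis e_metric : almost_metric e.
Hypothesis phi_bounded : -oo < ereal_inf (range phi).

Definition brondsted (x y : M) : Prop := phi y + (e x y)%:E <= phi x.

Lemma brondsted_refl x : brondsted x x.
Proof.
by rewrite /brondsted (almost_metric_eq0 e_metric x x).2 // adde0.
Qed.

Lemma brondsted_trans x y z :
  brondsted x y -> brondsted y z -> brondsted x z.
Proof.
move=> xy yz; apply: le_trans xy; apply: le_trans (leeD2r _ yz).
rewrite -addeA; apply: leeD2l.
by rewrite -EFinD lee_fin addrC; exact: almost_metric_triangle.
Qed.

Lemma brondsted_le x y : brondsted x y -> phi y <= phi x.
Proof.
by apply: le_trans; rewrite leeDl// lee_fin; exact: almost_metric_ge0.
Qed.

Lemma phi_gtNy x : -oo < phi x.
Proof.
by apply: lt_le_trans phi_bounded _; apply: ereal_inf_lbound; exists x.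
Qed.

Lemma phi_fin_num x : Dom phi x -> phi x \is a fin_num.
Proof. by move=> phix; rewrite fin_real// phi_gtNy. Qed.

(** If the infimum of [phi] over the successors of [x] is [+oo], then [x] itself
is near-minimal; so the choice is possible at every [x], which lets the chain
below be defined by plain recursion. *)
Lemma near_minimal_successor (x : M) (eps : R) : (0 < eps)%R ->
  exists y, brondsted x y /\
    forall z, brondsted x z -> phi y <= phi z + eps%:E.
Proof.
move=> eps0; set S := [set phi z | z in brondsted x].
have SNy : -oo < ereal_inf S.
  apply: lt_le_trans phi_bounded _.
  by apply: ereal_inf_le_tmp => _ [z _ <-]; exists z.
have [Sy|Sy] := eqVneq (ereal_inf S) +oo.
  exists x; split; first exact: brondsted_refl.
  move=> z xz; suff -> : phi z = +oo by rewrite leey.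
  by apply/eqP; rewrite -leye_eq -Sy; apply: ereal_inf_lbound; exists z.
have Sfin : ereal_inf S \is a fin_num by rewrite fin_real// SNy ltey.
have [_ [y xy <-] yS] := lb_ereal_inf_adherent eps0 Sfin.
exists y; split=> // z xz; apply: (le_trans (ltW yS)); apply: leeD2r.
by apply: ereal_inf_lbound; exists z.
Qed.

Lemma near_minimal_chain (u : M) : exists x_ : nat -> M,
  [/\ x_ 0%N = u, forall n, brondsted (x_ n) (x_ n.+1)
    & forall n z, brondsted (x_ n) z ->
        phi (x_ n.+1) <= phi z + (n.+1%:R^-1)%:E].
Proof.
have /choice[g gP] (nx : nat * M) := @near_minimal_successor nx.2 (nx.1.+1%:R^-1)
  ltac:(by rewrite invr_gt0).
pose x_ := fix x_ n := if n is m.+1 then g (m, x_ m) else u.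
by exists x_; split=> // n; have [] := gP (n, x_ n).
Qed.

Section Chain.
Variable x_ : nat -> M.
Hypothesis x0_dom : Dom phi (x_ 0%N).
Hypothesis x_chain : forall n, brondsted (x_ n) (x_ n.+1).

Lemma chain_brondsted n m : (n <= m)%N -> brondsted (x_ n) (x_ m).
Proof.
elim: m => [|m IH]; first by rewrite leqn0 => /eqP->; exact: brondsted_refl.
rewrite leq_eqVlt => /predU1P[->|/IH nm]; first exact: brondsted_refl.
exact: brondsted_trans nm (x_chain m).
Qed.

Lemma chain_dom n : Dom phi (x_ n).
Proof. exact: le_lt_trans (brondsted_le (chain_brondsted (leq0n n))) x0_dom. Qed.

Lemma chain_nonincreasing : nonincreasing_seq (phi \o x_).
Proof. by move=> n m nm; apply/brondsted_le/chain_brondsted. Qed.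

Let L := ereal_inf (range (phi \o x_)).

Lemma chain_limE : limn (phi \o x_) = L.
Proof. exact/cvg_lim/ereal_nonincreasing_cvgn/chain_nonincreasing. Qed.

Lemma chain_inf_le n : L <= phi (x_ n).
Proof. by apply: ereal_inf_lbound; exists n. Qed.

Lemma chain_inf_fin_num : L \is a fin_num.
Proof.
rewrite fin_real// (lt_le_trans phi_bounded) /=.
  exact: le_lt_trans (chain_inf_le 0) x0_dom.
by apply: ereal_inf_le_tmp => _ [n _ <-]; exists (x_ n).
Qed.

Lemma chain_dist_le n m : (n <= m)%N -> (e (x_ n) (x_ m))%:E <= phi (x_ n) - L.
Proof.
move=> nm; rewrite leeBrDl ?chain_inf_fin_num//.
exact: le_trans (leeD2r _ (chain_inf_le m)) (chain_brondsted nm).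
Qed.

Lemma chain_cauchy : am_cauchy e x_.
Proof.
move=> delta delta0.
have [_ [N _ <-] NL] := lb_ereal_inf_adherent delta0 chain_inf_fin_num.
exists N => p q Np pq; rewrite -lee_fin.
apply: (le_trans (chain_dist_le pq)); rewrite leeBlDl ?chain_inf_fin_num//.
exact: le_trans (chain_nonincreasing Np) (ltW NL).
Qed.

(** Passing to the lower limit in [e x_n x_m <= phi x_n - L] as [m] grows. *)
Lemma chain_brondsted_limit (d : M -> M -> R) (v : M) :
  (forall n, am_lsc d (e (x_ n))) -> am_cvg d x_ v -> phi v <= L ->
  forall n, brondsted (x_ n) v.
Proof.
move=> lsc x_v vL n.
have env : (e (x_ n) v)%:E <= phi (x_ n) - L.
  apply: le_trans (lsc n x_ v x_v) _.
  exact: (@limn_einf_le_near _ _ _ n) (@chain_dist_le n).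
rewrite leeBrDl ?chain_inf_fin_num// in env.
exact: le_trans (leeD2r _ vL) env.
Qed.

End Chain.

(** Ekeland's variational principle, as the existence of a Brondsted-maximal
point. Near-minimality along the chain is what makes the limit maximal: no
point above all the [x_n] can have a [phi]-value below their infimum. *)
Theorem ekeland_variational (d : M -> M -> R) (u : M) :
  am_compatible d e -> descending_complete d phi -> Dom phi u ->
  exists v, brondsted u v /\ forall y, brondsted v y -> y = v.
Proof.
move=> [e_d lsc] dphi u_dom.
have [x_ [x0 x_chain x_min]] := near_minimal_chain u; rewrite -x0 in u_dom *.
have [v [x_v]] := dphi x_ (chain_dom u_dom x_chain)
  (e_d _ (chain_cauchy u_dom x_chain)) (chain_nonincreasing x_chain).
rewrite (chain_limE x_chain) => vL.
have above := chain_brondsted_limit u_dom x_chain (fun n => lsc (x_ n)) x_v vL.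
exists v; split=> // y vy.
have Ly : ereal_inf (range (phi \o x_)) <= phi y.
  apply/lee_addgt0Pr => eps eps0; have [k] := ltr_add_invr eps0.
  rewrite add0r => keps; apply: (le_trans (chain_inf_le x_ k.+1)).
  apply: (le_trans (x_min k y (brondsted_trans (above k) vy))).
  by apply: leeD2l; rewrite lee_fin ltW.
have v_dom : Dom phi v := le_lt_trans (brondsted_le (above 0%N)) u_dom.
have evy : (e v y)%:E <= 0.
  rewrite -(@leeD2lE _ (phi v)) ?phi_fin_num// adde0.
  exact: le_trans (leeD2r _ (le_trans vL Ly)) vy.
apply/esym/(almost_metric_eq0 e_metric)/le_anti.
by rewrite -lee_fin evy (almost_metric_ge0 e_metric).
Qed.

End Ekeland.

Theorem theorem6 (R : realType) (M : Type) (F : M -> M -> \bar R)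
    (d e : M -> M -> R)
    (M_nonempty : inhabited M)
    (F_triangular : triangular F)
    (F_reflexive : reflexive_fun F)
    (d_metric : almost_metric d)
    (e_metric : almost_metric e)
    (mu_proper : Dom (mu F) !=set0)
    (dF_complete : semi_descending_complete d F)
    (e_compatible : am_compatible d e) :
  forall u : M, Dom (mu F) u ->
    exists v : M,
      [/\ [/\ (e u v)%:E <= - F u v, - F u v <= mu F u & mu F u < +oo],
          (forall x : M, x <> v -> - F v x < (e v x)%:E)
        & equilibrium_point (fun x y => F x y + (e x y)%:E) v].
Proof.
move=> u u_dom.
have [Fu_dom Fu_bounded] := inf_proper_section F_reflexive u_dom.
have uu_dom : Dom (F u) u by rewrite /Dom /= F_reflexive ltry.
have [v [uv v_max]] :=
  ekeland_variational e_metric Fu_bounded e_compatible (dF_complete u u_dom) uu_dom.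
have Fuv_fin : F u v \is a fin_num.
  apply: phi_fin_num => //.
  exact: le_lt_trans (brondsted_le e_metric uv) uu_dom.
have strict x : x <> v -> - F v x < (e v x)%:E.
  move=> xv; have /negP : ~ brondsted e (F u) v x by move=> /v_max.
  rewrite /brondsted -ltNge => lt_x.
  rewrite lteNl; have := F_triangular u v x (fin_num_adde_defr _ Fuv_fin).
  move=> /(leeD2r (e v x)%:E) /(lt_le_trans lt_x).
  rewrite -addeA -{1}(adde0 (F u v)) lteD2lE// => pos.
  by rewrite -sub0e lteBlDr.
exists v; split=> //.
  split=> //; last by apply: ereal_sup_ubound; exists v.
  move: uv; rewrite /brondsted F_reflexive.
  by rewrite -{1}[F u v]oppeK addeC leeBlDr ?fin_numN// add0e.
move=> x; have [->|xv] := pselect (x = v).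
  by rewrite F_reflexive (almost_metric_eq0 e_metric v v).2 // adde0.
by rewrite -leeBlDr// sub0e leeNl ltW// strict.
Qed.
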